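(* Let $(X,\Sigma_X,\mu)$ and $(Y,\Sigma_Y,\nu)$ be two measure spaces. Then the following statements are equivalent: (a) the pair $(\mu,\nu)$ is abelian; (b) $\mathcal{F}(\mu,\nu)=\{f:X\times Y\to[0,+\infty] \mid f \text{ is } (\Sigma_X\otimes\Sigma_Y)\text{-measurable}\}$.
   Context: No finiteness or $\sigma$-finiteness assumptions are made on the measures. $\Sigma_X\otimes\Sigma_Y$ denotes the $\sigma$-algebra on $X\times Y$ generated by the measurable rectangles $E\times F$ with $E\in\Sigma_X$, $F\in\Sigma_Y$. For $A\subseteq X\times Y$, write $A^y=\{x\in X\mid (x,y)\in A\}$ and $A_x=\{y\in Y\mid (x,y)\in A\}$ for its sections; for a function $f$ on $X\times Y$ write $f^y(x)=f(x,y)=f_x(y)$. If $A\in\Sigma_X\otimes\Sigma_Y$ all sections of $A$ are measurable, and sections of measurable functions are measurable. $\mathscr{A}(\mu,\nu)$ denotes the class of all $A\in\Sigma_X\otimes\Sigma_Y$ such that (i) $y\mapsto\mu(A^y)$ is $\Sigma_Y$-measurable; (ii) $x\mapsto\nu(A_x)$ is $\Sigma_X$-measurable; (iii) $\int_Y\mu(A^y)\,d\nu(y)=\int_X\nu(A_x)\,d\mu(x)$ (as elements of $[0,+\infty]$). The pair $(\mu,\nu)$ is called abelian if $\mathscr{A}(\mu,\nu)=\Sigma_X\otimes\Sigma_Y$. $\mathcal{F}(\mu,\nu)$ denotes the set of $(\Sigma_X\otimes\Sigma_Y)$-measurable functions $f:X\times Y\to[0,+\infty]$ such that (i) $y\mapsto\int_X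 f^y(x)\,d\mu(x)$ is $\Sigma_Y$-measurable on $Y$; (ii) $x\mapsto\int_Y f_x(y)\,d\nu(y)$ is $\Sigma_X$-measurable on $X$; (iii) $\int_Y\left(\int_X f^y(x)\,d\mu(x)\right)d\nu(y)=\int_X\left(\int_Y f_x(y)\,d\nu(y)\right)d\mu(x)$. *)

(* Defs.v *)
From HB Require Import structures.
From mathcomp Require Import all_boot all_order all_algebra.
From mathcomp Require Import all_classical all_reals all_analysis.
From mathcomp Require Import measurable_realfun.

Set Implicit Arguments.
Unset Strict Implicit.
Unset Printing Implicit Defensive.

Import Order.TTheory GRing.Theory Num.Theory.
Import numFieldNormedType.Exports.

Local Open Scope classical_set_scope.
Local Open Scope ring_scope.
Local Open Scope ereal_scope.

(* [measurable : set (set (X * Y))] is the library's product sigma-algebra; it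
   is the one generated by the rectangles [E `*` F] with [E] and [F] measurable
   (lemma [measurable_prod_measurableType]).  The sections A_x and A^y are
   [xsection A x] and [ysection A y]. *)

Section abelian_pairs.
Context (d1 d2 : measure_display) (X : measurableType d1)
  (Y : measurableType d2) (R : realType).
Variables (mu : {measure set X -> \bar R}) (nu : {measure set Y -> \bar R}).

Definition abelian_sets : set (set (X * Y)) :=
  [set A | [/\ measurable A,
    measurable_fun [set: Y] (fun y => mu (ysection A y)),
    measurable_fun [set: X] (fun x => nu (xsection A x)) &
    \int[nu]_y mu (ysection A y) = \int[mu]_x nu (xsection A x)]].

Definition abelian_pair : Prop := abelian_sets = measurable.

(* A function with values in [0, +oo] is a nonnegative function to [\bar R]. *)
Definition nonneg_measurable_funs : set (X * Y -> \bar R) :=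
  [set f | (forall z, 0 <= f z) /\ measurable_fun [set: X * Y] f].

Definition abelian_funs : set (X * Y -> \bar R) :=
  [set f | [/\ nonneg_measurable_funs f,
    measurable_fun [set: Y] (fun y => \int[mu]_x f (x, y)),
    measurable_fun [set: X] (fun x => \int[nu]_y f (x, y)) &
    \int[nu]_y (\int[mu]_x f (x, y)) = \int[mu]_x (\int[nu]_y f (x, y))]].

End abelian_pairs.

Arguments nonneg_measurable_funs {d1 d2} X Y R.

(* Main.v *)
Require Import Defs.
From HB Require Import structures.
From mathcomp Require Import all_boot all_order all_algebra finmap.
From mathcomp Require Import all_classical all_reals all_analysis.
From mathcomp Require Import measurable_realfun.

(** A measurable set is abelian exactly when its indicator lies in F(mu, nu).
    The class F(mu, nu) is stable under nonnegative linear combinations and, by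
    monotone convergence, under increasing limits; a nonnegative measurable
    function is an increasing limit of nonnegative simple functions. *)

Local Open Scope classical_set_scope.
Local Open Scope ring_scope.
Local Open Scope ereal_scope.

Section abelian_funs_closure.
Context {R : realType} {d1 d2 : measure_display}
  {X : measurableType d1} {Y : measurableType d2}
  (mu : {measure set X -> \bar R}) (nu : {measure set Y -> \bar R}).

(** The inner integrals of the indicator of [A] are the measures of the sections of [A], so the
    conditions defining the two classes coincide one by one. *)
Lemma abelian_funs_indic (A : set (X * Y)) : measurable A ->
  abelian_funs mu nu (EFin \o \1_A) <-> abelian_sets mu nu A.
Proof.
move=> mA.
have intx : (fun y => \int[mu]_x (EFin \o \1_A) (x, y)) =
    (fun y => mu (ysection A y)).
  (* [integral_indic] gives the measure of an intersection with the domain of integration, hence the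
     intersection with the full set introduced here. *)
  apply/funext => y; rewrite -[ysection A y]setIT -integral_indic//; last first.
    exact: measurable_ysection.
  by apply: eq_integral => x _ /=; rewrite !indicE mem_ysection.
have inty : (fun x => \int[nu]_y (EFin \o \1_A) (x, y)) =
    (fun x => nu (xsection A x)).
  apply/funext => x; rewrite -[xsection A x]setIT -integral_indic//; last first.
    exact: measurable_xsection.
  by apply: eq_integral => y _ /=; rewrite !indicE mem_xsection.
have nnA : nonneg_measurable_funs X Y R (EFin \o \1_A).
  by split=> [z|]; [rewrite lee_fin|exact/measurable_EFinP/measurable_indic].
by rewrite /abelian_funs /abelian_sets /= intx inty; split=> -[].
Qed.

Lemma abelian_funs0 : abelian_funs mu nu (cst 0).
Proof.
have int0 d (T : measurableType d) (m : {measure set T -> \bar R}) :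
  \int[m]_x (0 : \bar R) = 0 by exact: integral0.
split=> /=; first by split=> //; exact: measurable_cst.
- by under eq_fun do rewrite int0; exact: measurable_cst.
- by under eq_fun do rewrite int0; exact: measurable_cst.
- under eq_integral do rewrite int0.
  under [RHS]eq_integral do rewrite int0.
  by rewrite !int0.
Qed.

(** Additivity of the integral on nonnegative measurable functions is used at two levels: on
    sections for the inner integrals, then on the inner integrals themselves. *)
Lemma abelian_funsD (f g : X * Y -> \bar R) :
  abelian_funs mu nu f -> abelian_funs mu nu g -> abelian_funs mu nu (f \+ g).
Proof.
move=> [[f0 mf] mfx mfy fE] [[g0 mg] mgx mgy gE].
have intx y : \int[mu]_x (f \+ g) (x, y) =
    \int[mu]_x f (x, y) + \int[mu]_x g (x, y).
  by apply: ge0_integralD => //; exact: measurable_fun_pair1.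
have inty x : \int[nu]_y (f \+ g) (x, y) =
    \int[nu]_y f (x, y) + \int[nu]_y g (x, y).
  by apply: ge0_integralD => //; exact: measurable_fun_pair2.
split.
- by split=> [z|]; [exact: adde_ge0|exact: emeasurable_funD].
- by under eq_fun do rewrite intx; exact: emeasurable_funD.
- by under eq_fun do rewrite inty; exact: emeasurable_funD.
- under eq_integral do rewrite intx.
  under [RHS]eq_integral do rewrite inty.
  rewrite ge0_integralD//; [|by move=> *; exact: integral_ge0..].
  rewrite [RHS]ge0_integralD//; [|by move=> *; exact: integral_ge0..].
  by rewrite fE gE.
Qed.

(** Real coefficients suffice, since simple functions take real values. *)
Lemma abelian_funsZ (k : R) (f : X * Y -> \bar R) : (0 <= k)%R ->
  abelian_funs mu nu f -> abelian_funs mu nu (fun z => k%:E * f z).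
Proof.
move=> k0 [[f0 mf] mfx mfy fE].
have intx y : \int[mu]_x (k%:E * f (x, y)) = k%:E * \int[mu]_x f (x, y).
  by apply: ge0_integralZl_EFin => //; exact: measurable_fun_pair1.
have inty x : \int[nu]_y (k%:E * f (x, y)) = k%:E * \int[nu]_y f (x, y).
  by apply: ge0_integralZl_EFin => //; exact: measurable_fun_pair2.
split.
- by split=> [z|]; [exact: mule_ge0|exact: measurable_funeM].
- by under eq_fun do rewrite intx; exact: measurable_funeM.
- by under eq_fun do rewrite inty; exact: measurable_funeM.
- under eq_integral do rewrite intx.
  under [RHS]eq_integral do rewrite inty.
  rewrite ge0_integralZl_EFin//; [|by move=> *; exact: integral_ge0].
  rewrite [RHS]ge0_integralZl_EFin//; [|by move=> *; exact: integral_ge0].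
  by rewrite fE.
Qed.

(** The hypothesis is restricted to members of [s] because, for a simple function, the coefficients
    are known to be nonnegative only when they are attained values. *)
Lemma abelian_funs_sum (I : eqType) (s : seq I) (f : I -> X * Y -> \bar R) :
  (forall i, i \in s -> abelian_funs mu nu (f i)) ->
  abelian_funs mu nu (fun z => \sum_(i <- s) f i z).
Proof.
elim: s => [_|i s ih sf].
  by under eq_fun do rewrite big_nil; exact: abelian_funs0.
under eq_fun do rewrite big_cons.
apply: abelian_funsD; first by apply: sf; rewrite mem_head.
by apply: ih => j js; apply: sf; rewrite in_cons js orbT.
Qed.

(** Monotone convergence on each section makes the inner integrals of [f] pointwise limits of those
    of [g n], hence measurable; a second application handles the outer integrals. *)
Lemma abelian_funs_nondecreasing_lim (g : (X * Y -> \bar R)^nat)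
    (f : X * Y -> \bar R) :
  (forall n, abelian_funs mu nu (g n)) ->
  (forall z, nondecreasing_seq (g^~ z)) ->
  (forall z, g n z @[n --> \oo] --> f z) ->
  abelian_funs mu nu f.
Proof.
move=> gF ndg gf.
have g0 n z : 0 <= g n z by have [[]] := gF n.
have mg n : measurable_fun setT (g n) by have [[]] := gF n.
have mgx n : measurable_fun setT (fun y => \int[mu]_x g n (x, y)).
  by have [] := gF n.
have mgy n : measurable_fun setT (fun x => \int[nu]_y g n (x, y)).
  by have [] := gF n.
have fE z : f z = limn (g^~ z) by apply/esym/cvg_lim => //; exact: gf.
have f0 z : 0 <= f z.
  rewrite fE; apply: lime_ge; first by apply/cvg_ex; exists (f z); exact: gf.
  exact: nearW.
have cvgx y : \int[mu]_x g n (x, y) @[n --> \oo] --> \int[mu]_x f (x, y).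
  under eq_integral do rewrite fE.
  apply: cvg_monotone_convergence => // n.
  exact: measurable_fun_pair1.
have cvgy x : \int[nu]_y g n (x, y) @[n --> \oo] --> \int[nu]_y f (x, y).
  under eq_integral do rewrite fE.
  apply: cvg_monotone_convergence => // n.
  exact: measurable_fun_pair2.
(* The inner integrals must themselves increase with [n] for monotone convergence to apply to the
   outer ones. *)
have ndx y : nondecreasing_seq (fun n => \int[mu]_x g n (x, y)).
  move=> m n mn; apply: ge0_le_integral => //.
  - exact: measurable_fun_pair1.
  - exact: measurable_fun_pair1.
  - by move=> x _; exact: ndg.
have ndy x : nondecreasing_seq (fun n => \int[nu]_y g n (x, y)).
  move=> m n mn; apply: ge0_le_integral => //.
  - exact: measurable_fun_pair2.
  - exact: measurable_fun_pair2.
  - by move=> y _; exact: ndg.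
split.
- by split=> //; apply: emeasurable_fun_cvg mg _ => z _; exact: gf.
- by apply: emeasurable_fun_cvg mgx _ => y _; exact: cvgx.
- by apply: emeasurable_fun_cvg mgy _ => x _; exact: cvgy.
(* Each iterated integral of [f] is the limit of the corresponding ones of [g n], and these agree
   for every [n]. *)
- transitivity (limn (fun n => \int[nu]_y \int[mu]_x g n (x, y))).
    rewrite -monotone_convergence//; last first.
      by move=> n y _; exact: integral_ge0.
    by apply: eq_integral => y _; apply/esym/cvg_lim => //; exact: cvgx.
  transitivity (limn (fun n => \int[mu]_x \int[nu]_y g n (x, y))).
    by congr (limn _); apply/funext => n; have [] := gF n.
  rewrite -monotone_convergence//; last first.
    by move=> n x _; exact: integral_ge0.
  by apply: eq_integral => x _; apply/cvg_lim => //; exact: cvgy.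
Qed.

Import HBNNSimple.

Lemma abelian_funs_nnsfun (h : {nnsfun (X * Y)%type >-> R}) :
  abelian_pair mu nu -> abelian_funs mu nu (EFin \o h).
Proof.
move=> ab.
have -> : EFin \o h = fun z => \sum_(r <- fset_set (range h))
    r%:E * (EFin \o \1_(h @^-1` [set r])) z.
  apply/funext => z /=; rewrite fimfunE fsbig_finite//= -sumEFin.
  by apply: eq_bigr => r _; rewrite EFinM.
(* Writing the coefficient as an attained value [h z] makes it nonnegative. *)
apply: abelian_funs_sum => r; rewrite in_fset_set// inE => -[z _ <-].
apply: abelian_funsZ; first exact: fun_ge0.
have mh : measurable (h @^-1` [set h z]) by exact: measurable_sfunP.
by apply/abelian_funs_indic => //; rewrite ab.
Qed.

Lemma abelian_pair_nonneg_measurable_funs :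
  abelian_pair mu nu -> nonneg_measurable_funs X Y R `<=` abelian_funs mu nu.
Proof.
move=> ab f [f0 mf].
(* These simple functions increase to [f] everywhere, including where [f] is infinite. *)
pose g := nnsfun_approx measurableT mf.
apply: (abelian_funs_nondecreasing_lim (fun n => EFin \o g n)).
- by move=> n; exact: abelian_funs_nnsfun.
- move=> z m n mn; rewrite lee_fin.
  exact/lefP/nd_nnsfun_approx.
- by move=> z; exact: cvg_nnsfun_approx.
Qed.

End abelian_funs_closure.

Theorem theorem2p16 (R : realType) (d1 d2 : measure_display)
    (X : measurableType d1) (Y : measurableType d2)
    (mu : {measure set X -> \bar R}) (nu : {measure set Y -> \bar R}) :
  abelian_pair mu nu <->
  abelian_funs mu nu = nonneg_measurable_funs X Y R.
Proof.
split=> [ab|FE].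
- apply/seteqP; split=> [f []//|].
  exact: abelian_pair_nonneg_measurable_funs.
(* Conversely, the indicator of a measurable set is nonnegative and measurable, so [FE] puts it in
   [abelian_funs]. *)
- apply/seteqP; split=> [A []//|A mA].
  apply/abelian_funs_indic => //; rewrite FE; split=> [z|].
  + by rewrite lee_fin.
  + exact/measurable_EFinP/measurable_indic.
Qed.
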